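(* Let $F$ be an algebraically closed field of characteristic zero, $G$ a finite abelian group, and $R=M_{n,n}(F)$ a non-trivial matrix superalgebra with an elementary $G$-grading and a superinvolution $*$ that respects this $G$-grading. If $*$ is transpose, then $R$, as a graded superalgebra with superinvolution, is isomorphic to $M_{n,n}(F)$ with the elementary grading defined by a $2n$-tuple $$(g'_1,\ldots,g'_{2n})=(g_1^{(p_1)},\ldots,g_r^{(p_r)},g_{i_1}^{(q_{i_1})},\ldots,g_{i_r}^{(q_{i_r})}),$$ where $g_i\neq g_j$ for $i\neq j$, $(i_1,\ldots,i_r)$ is a permutation of $(1,\ldots,r)$, $p_1+\cdots+p_r=n$, $q_1+\cdots+q_r=n$, and $g_1g_{i_1}=g_2g_{i_2}=\cdots=g_rg_{i_r}$, with the superinvolution $X\mapsto X^*=\Phi^{-1}X^{\tau}\Phi$ where $$\Phi=\begin{pmatrix}0&I_n\\ I_n&0\end{pmatrix}.$$ Moreover, in this realization, $K(R,* )$ consists of all matrices of the type $$\begin{pmatrix}A&B\\ C&-A^t\end{pmatrix}$$ where $A$ is any $n\times n$ matrix, $B$ is a symmetric matrix of order $n$ and $C$ is a skew-symmetric matrix of order $n$, and $H(R,* )$ consists of all matrices of the type $$\begin{pmatrix}A&B\\ C&A^t\end{pmatrix}$$ where $A$ is any $n\times n$ matrix, $B$ is skew-symmetric of order $n$ and $C$ is symmetric of order $n$.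
   Context: $M_{n,n}(F)$ denotes the algebra $M_{2n}(F)$ of block matrices $X=\begin{pmatrix}A&B\\ C&D\end{pmatrix}$ with all blocks $n\times n$, with the $\mathbb{Z}_2$-grading whose even part is given by $B=0,C=0$ and odd part by $A=0,D=0$. It is non-trivial if its odd part is nonzero. For such $X$ put $X^{\tau}=\begin{pmatrix}A&-B\\ C&D\end{pmatrix}^t$, where $t$ is the ordinary transpose. A superinvolution on an associative superalgebra $R$ is a $\mathbb{Z}_2$-graded linear map $*:R\to R$ of order 2 with $(ab)^*=(-1)^{|a||b|}b^*a^*$ for homogeneous $a,b$. $H(R,* )=\{x: x^*=x\}$ and $K(R,* )=\{x:x^*=-x\}$. A superinvolution of $M_{n,n}(F)$ is called transpose if, in an appropriate basis (up to conjugation by an automorphism of the superalgebra), it has the form $$\begin{pmatrix}A&B\\ C&D\end{pmatrix}\mapsto\begin{pmatrix}D^t&-B^t\\ C^t&A^t\end{pmatrix}.$$ A $G$-grading of a superalgebra $R$ is a decomposition $R=\bigoplus_{g\in G}R_g$ with $R_gR_h\subseteq R_{gh}$ and $R_g=(R_g\cap R_{\bar 0})\oplus(R_g\cap R_{\bar 1})$. It is respected by $*$ if $(R_g)^*=R_g$ for all $g$. A $G$-grading of a matrix algebra $M_N(F)$ is elementary if there are an $N$-tuple $(g_1,\ldots,g_N)\in G^N$ and a system of matrix units $E_{ij}$ that are homogeneous with $E_{ij}\in R_g$ if and only if $g=g_i^{-1}g_j$; for a matrix superalgebra these matrix units of the underlying algebra need not a priori be adapted to the $\mathbb{Z}_2$-grading.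 In the conclusion, the elementary grading is taken with respect to the standard matrix units of $M_{n,n}(F)$. The notation $g^{(p)}$ in a tuple means that $g$ is repeated $p$ times; the $p_i,q_i$ are nonnegative integers. $I_n$ is the identity matrix of order $n$. *)

(* Defs.v *)
From HB Require Import structures.
From mathcomp Require Import all_boot all_order all_algebra all_fingroup.

Set Implicit Arguments.
Unset Strict Implicit.
Unset Printing Implicit Defensive.

Import GRing.Theory.
Local Open Scope ring_scope.

(* The superalgebra M_{n,n}(F) is carried by 'M[F]_(n + n), with its canonical
   decomposition into n x n blocks; false indexes the even part and true the
   odd part. *)
Definition superpart (F : fieldType) (n : nat) (b : bool) :
    {vspace 'M[F]_(n + n)} :=
  if b then (lker (linfun (@ulsubmx F n n n n)) :&:
             lker (linfun (@drsubmx F n n n n)))%VS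
  else (lker (linfun (@ursubmx F n n n n)) :&:
        lker (linfun (@dlsubmx F n n n n)))%VS.

Lemma mem_superpart (F : fieldType) (n : nat) (b : bool)
    (X : 'M[F]_(n + n)) :
  (X \in superpart F n b) =
  if b then (ulsubmx X == 0) && (drsubmx X == 0)
  else (ursubmx X == 0) && (dlsubmx X == 0).
Proof.
have ul Y : linfun (@ulsubmx F n n n n) Y = ulsubmx Y.
  exact: (lfunE (@lsubmx F n n n \o @usubmx F n n (n + n)) Y).
have ur Y : linfun (@ursubmx F n n n n) Y = ursubmx Y.
  exact: (lfunE (@rsubmx F n n n \o @usubmx F n n (n + n)) Y).
have dl Y : linfun (@dlsubmx F n n n n) Y = dlsubmx Y.
  exact: (lfunE (@lsubmx F n n n \o @dsubmx F n n (n + n)) Y).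
have dr Y : linfun (@drsubmx F n n n n) Y = drsubmx Y.
  exact: (lfunE (@rsubmx F n n n \o @dsubmx F n n (n + n)) Y).
by case: b; rewrite memv_cap !memv_ker ?ul ?ur ?dl ?dr.
Qed.

Definition nontrivial_superalgebra (F : fieldType) (n : nat) : Prop :=
  superpart F n true <> 0%VS.

(* f(U) = V. *)
Definition maps_onto (F : fieldType) (vT : vectType F) (f : vT -> vT)
    (U V : {vspace vT}) : Prop :=
  forall y, y \in V <-> exists2 x, x \in U & y = f x.

Definition superautomorphism (F : fieldType) (n : nat)
    (phi : 'M[F]_(n + n) -> 'M[F]_(n + n)) : Prop :=
  [/\ linear phi, bijective phi,
      forall X Y, phi (X *m Y) = phi X *m phi Y
    & forall b, maps_onto phi (superpart F n b) (superpart F n b)].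

Definition superinvolution (F : fieldType) (n : nat)
    (star : 'M[F]_(n + n) -> 'M[F]_(n + n)) : Prop :=
  [/\ linear star, involutive star,
      forall b X, X \in superpart F n b -> star X \in superpart F n b
    & forall a b X Y, X \in superpart F n a -> Y \in superpart F n b ->
        star (X *m Y) = (-1) ^+ (a && b) *: (star Y *m star X)].

Definition supergrading (F : fieldType) (n : nat) (gT : finGroupType)
    (Rg : gT -> {vspace 'M[F]_(n + n)}) : Prop :=
  [/\ directv (\sum_g Rg g)%VS, (\sum_g Rg g)%VS = fullv,
      forall g h X Y, X \in Rg g -> Y \in Rg h -> X *m Y \in Rg (g * h)%g
    & forall g,
        Rg g = (Rg g :&: superpart F n false + Rg g :&: superpart F n true)%VS
        /\ directv (Rg g :&: superpart F n false
                    + Rg g :&: superpart F n true)%VS].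

Definition graded_superinvolution (F : fieldType) (n : nat)
    (gT : finGroupType) (Rg : gT -> {vspace 'M[F]_(n + n)})
    (star : 'M[F]_(n + n) -> 'M[F]_(n + n)) : Prop :=
  [/\ supergrading Rg, superinvolution star
    & forall g, maps_onto star (Rg g) (Rg g)].

Definition graded_star_isomorphism (F : fieldType) (n : nat)
    (gT : finGroupType)
    (Rg : gT -> {vspace 'M[F]_(n + n)})
    (star : 'M[F]_(n + n) -> 'M[F]_(n + n))
    (Rg' : gT -> {vspace 'M[F]_(n + n)})
    (star' : 'M[F]_(n + n) -> 'M[F]_(n + n))
    (phi : 'M[F]_(n + n) -> 'M[F]_(n + n)) : Prop :=
  [/\ superautomorphism phi, forall g, maps_onto phi (Rg g) (Rg' g)
    & forall X, phi (star X) = star' (phi X)].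

Definition matrix_units (F : fieldType) (N : nat)
    (E : 'I_N -> 'I_N -> 'M[F]_N) : Prop :=
  (forall i j k l, E i j *m E k l = if j == k then E i l else 0)
  /\ \sum_i E i i = 1%:M.

Definition elementary_wrt (F : fieldType) (N : nat) (gT : finGroupType)
    (E : 'I_N -> 'I_N -> 'M[F]_N) (t : N.-tuple gT)
    (Rg : gT -> {vspace 'M[F]_N}) : Prop :=
  forall i j g, E i j \in Rg g <-> g = ((tnth t i)^-1 * tnth t j)%g.

(* The matrix units are not required to be homogeneous for the Z/2-grading. *)
Definition elementary_grading (F : fieldType) (N : nat) (gT : finGroupType)
    (Rg : gT -> {vspace 'M[F]_N}) : Prop :=
  exists (t : N.-tuple gT) (E : 'I_N -> 'I_N -> 'M[F]_N),
    matrix_units E /\ elementary_wrt E t Rg.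

Definition transpose_star (F : fieldType) (n : nat) (X : 'M[F]_(n + n)) :
    'M[F]_(n + n) :=
  block_mx (drsubmx X)^T (- (ursubmx X)^T) (dlsubmx X)^T (ulsubmx X)^T.

Definition is_transpose (F : fieldType) (n : nat)
    (star : 'M[F]_(n + n) -> 'M[F]_(n + n)) : Prop :=
  exists2 theta, superautomorphism theta
    & forall X, theta (star X) = transpose_star (theta X).

Definition mxtau (F : fieldType) (n : nat) (X : 'M[F]_(n + n)) :
    'M[F]_(n + n) :=
  (block_mx (ulsubmx X) (- ursubmx X) (dlsubmx X) (drsubmx X))^T.

Definition mxPhi (F : fieldType) (n : nat) : 'M[F]_(n + n) :=
  block_mx 0 1%:M 1%:M 0.

Definition Phi_star (F : fieldType) (n : nat) (X : 'M[F]_(n + n)) :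
    'M[F]_(n + n) :=
  invmx (mxPhi F n) *m mxtau X *m mxPhi F n.

Definition symmetric_elt (F : fieldType) (n : nat)
    (star : 'M[F]_(n + n) -> 'M[F]_(n + n)) (X : 'M[F]_(n + n)) : Prop :=
  star X = X.

Definition skew_elt (F : fieldType) (n : nat)
    (star : 'M[F]_(n + n) -> 'M[F]_(n + n)) (X : 'M[F]_(n + n)) : Prop :=
  star X = - X.

(* (g_1^(p_1), ..., g_r^(p_r), g_{s 1}^(q_{s 1}), ..., g_{s r}^(q_{s r})) *)
Definition paired_seq (gT : finGroupType) (r : nat) (g : 'I_r -> gT)
    (p q : 'I_r -> nat) (s : {perm 'I_r}) : seq gT :=
  flatten [seq nseq (p i) (g i) | i <- enum 'I_r]
  ++ flatten [seq nseq (q (s i)) (g (s i)) | i <- enum 'I_r].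

(* Main.v *)
Require Import Defs.
From HB Require Import structures.
From mathcomp Require Import all_boot all_order all_algebra all_fingroup.

Set Implicit Arguments.
Unset Strict Implicit.
Unset Printing Implicit Defensive.

Import GRing.Theory.
Local Open Scope ring_scope.

(* After conjugation by an automorphism of the superalgebra, the superinvolution
   is X |-> Phi^-1 X^tau Phi.  Multiplying it by a square root of -1 on the odd
   part gives an ordinary anti-automorphism respecting the G-grading, hence the
   adjunction of a nondegenerate bilinear form on the G-graded space F^(2n);
   this form pairs degree x only with degree g0 x^-1.  Its asymmetry is, up to a
   scalar, diag(1, -1), which therefore has trivial degree: the even and odd
   halves of F^(2n) are graded subspaces, and they are dual to each other.  A
   homogeneous basis of the first half, with degrees u_i, and its dual basis,
   with degrees g0 u_i^-1, realize the grading; passing to dual bases is the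
   conjugation by diag(Q, Q^-T), which commutes with X |-> Phi^-1 X^tau Phi.
   In the theorem the g_i enumerate all of G (some p_i, q_i being 0), so that
   s is the permutation x |-> g0 x^-1. *)

(** * Degree-preserving matrices and homogeneous bases *)

Section Homogeneous.

Variables (F : fieldType) (gT : finGroupType).
Implicit Types m n p : nat.

(* Degree-preserving matrices, for rows labelled by a and columns by b; an
   element of degree h is a degree-preserving one with relabelled rows. *)
Definition deg_preserving m n (a : 'I_m -> gT) (b : 'I_n -> gT)
    (A : 'M[F]_(m, n)) : Prop :=
  forall i j, A i j != 0 -> a i = b j.

Lemma deg_preserving_mul m n p (a : 'I_m -> gT) (b : 'I_n -> gT)
    (c : 'I_p -> gT) (A : 'M[F]_(m, n)) (B : 'M_(n, p)) :
  deg_preserving a b A -> deg_preserving b c B -> deg_preserving a c (A *m B).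
Proof.
move=> hA hB i j; apply: contra_neq_eq => ne; rewrite mxE big1 // => k _.
apply/eqP; rewrite mulf_eq0; apply/norP=> -[/hA ab /hB bc].
by rewrite ab bc eqxx in ne.
Qed.

Lemma deg_preservingD m n (a : 'I_m -> gT) (b : 'I_n -> gT)
    (A B : 'M[F]_(m, n)) :
  deg_preserving a b A -> deg_preserving a b B -> deg_preserving a b (A + B).
Proof.
move=> hA hB i j; rewrite mxE.
have [->|/hA //] := eqVneq (A i j) 0.
by rewrite add0r => /hB.
Qed.

Lemma deg_preservingZ m n (a : 'I_m -> gT) (b : 'I_n -> gT) c
    (A : 'M[F]_(m, n)) :
  deg_preserving a b A -> deg_preserving a b (c *: A).
Proof. by move=> hA i j; rewrite mxE mulf_eq0 => /norP[_ /hA]. Qed.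

Lemma deg_preserving1 n (a : 'I_n -> gT) : deg_preserving a a 1%:M.
Proof.
by move=> i j; rewrite mxE; have [->|] := eqVneq i j; rewrite // eqxx.
Qed.

Definition deg_proj n (a : 'I_n -> gT) (g : gT) : 'M[F]_n :=
  diag_mx (\row_j (a j == g)%:R).

(** Entrywise, both products multiply [A i j] by the indicator of a label equal to [g]: that of row
    [i] on the left, of column [j] on the right. Being an intertwining relation, the condition
    passes at once to inverses and to compressions by other matrices. *)
Lemma deg_proj_comm m n (a : 'I_m -> gT) (b : 'I_n -> gT) (A : 'M[F]_(m, n)) :
  deg_preserving a b A <->
  forall g, deg_proj a g *m A = A *m deg_proj b g.
Proof.
have L g i j : (deg_proj a g *m A) i j = (a i == g)%:R * A i j.
  by rewrite mul_diag_mx !mxE.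
have R g i j : (A *m deg_proj b g) i j = A i j * (b j == g)%:R.
  by rewrite mul_mx_diag !mxE.
split=> [hA g | hA i j nz].
  apply/matrixP=> i j; rewrite L R mulrC.
  by have [->|/hA ->] := eqVneq (A i j) 0; rewrite ?mul0r.
apply/esym/eqP; move/matrixP/(_ i j): (hA (a i)); rewrite L R eqxx mul1r.
by case: eqP => // _ /eqP; rewrite mulr0 (negPf nz).
Qed.

Lemma deg_proj_sum n (a : 'I_n -> gT) : \sum_g deg_proj a g = 1%:M.
Proof.
rewrite -raddf_sum -diag_const_mx; congr diag_mx; apply/rowP=> j.
rewrite summxE mxE (bigD1 (a j)) //= mxE eqxx big1 ?addr0 // => g ng.
by rewrite mxE eq_sym (negPf ng).
Qed.

Lemma deg_projM n (a : 'I_n -> gT) g h :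
  deg_proj a g *m deg_proj a h = (g == h)%:R *: deg_proj a h.
Proof.
apply/matrixP=> i j; rewrite mul_diag_mx !mxE.
case: (eqVneq i j) => [->|_]; rewrite ?mulr0n ?mulr0 // !mulr1n.
have [->|ne] := eqVneq (a j) h; last by rewrite !mulr0.
by rewrite !mulr1 eq_sym.
Qed.

Lemma deg_preserving_inv n (a b : 'I_n -> gT) (A : 'M[F]_n) :
  A \in unitmx -> deg_preserving a b A -> deg_preserving b a (invmx A).
Proof.
move=> uA /deg_proj_comm hA; apply/deg_proj_comm => g.
by rewrite -[X in X *m invmx A](mulKmx uA) -hA !mulmxA mulmxK.
Qed.

(* The pieces of an idempotent decomposition of F^n together span, so a basis
   of F^n can be extracted from their rows. *)
Lemma homogeneous_basis n (Pi : gT -> 'M[F]_n) :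
  (forall g h, Pi g *m Pi h = (g == h)%:R *: Pi h) -> \sum_g Pi g = 1%:M ->
  exists (u : 'I_n -> gT) (Q : 'M[F]_n),
    Q \in unitmx /\ forall g, deg_proj u g *m Q = Q *m Pi g.
Proof.
move=> PiM Pi1.
pose lab (k : 'I_#|{: 'I_n * gT}|) := (enum_val k).2.
pose A := \matrix_(k < #|{: 'I_n * gT}|) row (enum_val k).1 (Pi (lab k)).
have fA : row_full A.
  rewrite -sub1mx; apply/row_subP=> i; rewrite -Pi1 raddf_sum /=.
  apply: summx_sub => g _.
  have -> : row i (Pi g) = row (enum_rank (i, g)) A.
    by rewrite rowK /lab enum_rankK.
  exact: row_sub.
exists (lab \o fullrankfun fA), (rowsub (fullrankfun fA) A).
split=> [|g]; first exact: fullrowsub_unit.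
apply/row_matrixP=> i; rewrite !row_mul row_rowsub rowK.
rewrite row_diag_mx mxE -scalemxAl -rowE row_rowsub rowK -row_mul PiM.
by rewrite linearZ /=; case: eqP => [<-|_]; rewrite ?scale1r ?scale0r.
Qed.

(** Since the [E i i] sum to 1, some [E a a] has a nonzero entry (b, c). The vectors [row b (E a i)]
    are permuted by the [E k l] as standard basis vectors are by [delta_mx k l], so the matrix [S]
    with these rows intertwines the two systems. *)
Lemma matrix_units_conj N (E : 'I_N -> 'I_N -> 'M[F]_N) :
  matrix_units E ->
  exists2 S, S \in unitmx
    & forall i j, E i j = invmx S *m delta_mx i j *m S.
Proof.
case: N E => [|N] E [EM E1].
  by exists 1%:M; [exact: unitmx1 | case].
have /existsP[a nz]: [exists a, E a a != 0].
  apply: contraTT isT => /existsPn E0.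
  have /eqP := oner_neq0 'M[F]_N.+1; case; rewrite -[1]E1 big1 // => i _.
  by have := E0 i; rewrite negbK => /eqP.
have /matrix0Pn[b [c nzc]] := nz.
pose S := \matrix_i row b (E a i).
have SE k l : S *m E k l = delta_mx k l *m S.
  apply/row_matrixP=> i; rewrite row_mul rowK -row_mul EM.
  rewrite [RHS]row_mul [X in X *m S]rowE mul_delta_mx_cond.
  by case: eqVneq => _; rewrite ?raddf0 ?mul0mx // -rowE rowK.
have uS : S \in unitmx.
  (* If v S = 0, then 0 = v S [E k a] = v [delta_mx k a] S, which is v_k times row b of [E a a]; its
     entry at c gives v_k = 0. *)
  rewrite -row_free_unit -kermx_eq0; apply/eqP/matrixP=> r k; rewrite [RHS]mxE.
  have := mulmx_ker S; move/(congr1 (mulmxr (E k a))) => /=.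
  rewrite mul0mx -mulmxA SE mulmxA -(mul_delta_mx (0 : 'I_1)) mulmxA -colE.
  rewrite -mulmxA -rowE => /matrixP/(_ r c); rewrite !mxE big_ord1 !mxE.
  by move/eqP; rewrite mulf_eq0 (negPf nzc) orbF => /eqP.
exists S => // i j.
by rewrite -mulmxA -SE mulKmx.
Qed.

(** Sorts the labels into constant blocks following the enumeration of [gT]. The block lengths are
    counted in the sorted list itself, which is legitimate because a permutation preserves
    multiplicities. *)
Lemma codom_perm_flatten n (u : 'I_n -> gT) :
  exists s : 'S_n, codom (u \o s) =
    flatten [seq nseq (count_mem (enum_val i) (codom (u \o s))) (enum_val i)
            | i <- enum 'I_#|gT|].
Proof.
pose w := flatten [seq nseq (count_mem (enum_val i) (codom u)) (enum_val i)
                  | i <- enum 'I_#|gT|].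
have w_u : perm_eq w (mktuple u).
  apply/allP=> x _ /=; rewrite count_flatten -map_comp sumnE big_map big_enum /=.
  rewrite (bigD1 (enum_rank x)) //= count_nseq enum_rankK /= eqxx mul1n.
  rewrite big1 ?addn0 => [|i ni]; first exact: eqxx.
  rewrite count_nseq /=; case: eqP => // e; case/eqP: ni.
  by rewrite -e enum_valK.
have [s ws] := tuple_permP w_u; exists s.
have -> : codom (u \o s) = w.
  by rewrite ws codomE /=; apply: eq_map => i; rewrite /= tnth_mktuple.
rewrite {1}/w; congr flatten; apply: eq_map => i; congr nseq.
exact/esym/(seq.permP w_u).
Qed.

End Homogeneous.

Arguments deg_proj {F gT n}.

(** * Parity, [Phi_star], and conjugation by dual bases *)

Section Superalgebra.

Variables (F : fieldType) (n : nat).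
Implicit Types (X : 'M[F]_(n + n)) (phi star : 'M[F]_(n + n) -> 'M[F]_(n + n)).

Lemma superpart_even X :
  X \in superpart F n false -> exists A D, X = block_mx A 0 0 D.
Proof.
rewrite mem_superpart => /andP[/eqP e1 /eqP e2].
by exists (ulsubmx X), (drsubmx X); rewrite -[LHS]submxK e1 e2.
Qed.

Lemma superpart_odd X :
  X \in superpart F n true -> exists B C, X = block_mx 0 B C 0.
Proof.
rewrite mem_superpart => /andP[/eqP e1 /eqP e2].
by exists (ursubmx X), (dlsubmx X); rewrite -[LHS]submxK e1 e2.
Qed.

Lemma even_odd_direct : (superpart F n false :&: superpart F n true = 0)%VS.
Proof.
apply/eqP; rewrite -subv0; apply/subvP=> X; rewrite memv_cap => /andP[].
case/superpart_even=> A [D ->]; rewrite mem_superpart block_mxKul block_mxKdr.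
by case/andP=> /eqP -> /eqP ->; rewrite block_mx0 mem0v.
Qed.

Lemma linear_lfun phi : linear phi -> exists f : 'End('M[F]_(n + n)), f =1 phi.
Proof.
move=> lin_phi; pose a := GRing.isLinear.Build _ _ _ _ phi lin_phi.
by exists (linfun (HB.pack_for {linear 'M[F]_(n + n) -> 'M[F]_(n + n)} phi a));
   move=> X; rewrite lfunE.
Qed.

Lemma superautomorphism_comp phi psi :
  superautomorphism phi -> superautomorphism psi ->
  superautomorphism (phi \o psi).
Proof.
case=> l1 b1 m1 o1 [l2 b2 m2 o2]; split.
- by move=> a X Y; rewrite /= l2 l1.
- exact: bij_comp.
- by move=> X Y; rewrite /= m2 m1.
move=> b Y; split=> [/o1[Z /o2[X hX ->] ->]|[X hX ->]]; first by exists X.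
by apply/o1; exists (psi X) => //; apply/o2; exists X.
Qed.

Lemma Phi_starE X : Phi_star X = transpose_star X.
Proof.
rewrite /Phi_star; have -> : invmx (mxPhi F n) = mxPhi F n.
  have PP : mxPhi F n *m mxPhi F n = 1%:M.
    rewrite /mxPhi mulmx_block !mulmx0 !mul0mx !mulmx1 !addr0 !add0r.
    by rewrite -scalar_mx_block.
  have [uP _] := mulmx1_unit PP.
  by rewrite -[LHS]mulmx1 -PP mulKmx.
rewrite /mxPhi /mxtau /transpose_star tr_block_mx !mulmx_block.
by rewrite !(mulmx0, mul0mx, mulmx1, mul1mx, addr0, add0r) linearN.
Qed.

Lemma Phi_star_block (A B C D : 'M[F]_n) :
  Phi_star (block_mx A B C D) = block_mx D^T (- B^T) C^T A^T.
Proof.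
rewrite Phi_starE /transpose_star.
by rewrite block_mxKul block_mxKur block_mxKdl block_mxKdr.
Qed.

Lemma skew_Phi_star X :
  skew_elt (@Phi_star F n) X <->
  exists A B C : 'M[F]_n,
    [/\ B^T = B, C^T = - C & X = block_mx A B C (- A^T)].
Proof.
rewrite /skew_elt; split=> [|[A [B [C [sB sC ->]]]]].
  rewrite -{1 2}(submxK X) Phi_star_block opp_block_mx.
  case/eq_block_mx=> e1 e2 e3 e4.
  exists (ulsubmx X), (ursubmx X), (dlsubmx X); split=> //.
    exact: oppr_inj.
  by rewrite e4 opprK submxK.
by rewrite Phi_star_block opp_block_mx sB sC linearN /= trmxK opprK.
Qed.

Lemma symmetric_Phi_star X :
  symmetric_elt (@Phi_star F n) X <->
  exists A B C : 'M[F]_n,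
    [/\ B^T = - B, C^T = C & X = block_mx A B C A^T].
Proof.
rewrite /symmetric_elt; split=> [|[A [B [C [sB sC ->]]]]].
  rewrite -{1 2}(submxK X) Phi_star_block => /eq_block_mx[e1 e2 e3 e4].
  exists (ulsubmx X), (ursubmx X), (dlsubmx X); split=> //.
    by rewrite -[in RHS]e2 opprK.
  by rewrite e4 submxK.
by rewrite Phi_star_block sB sC trmxK opprK.
Qed.

Definition dual_diag (Q : 'M[F]_n) : 'M[F]_(n + n) :=
  block_mx Q 0 0 (invmx Q)^T.

Lemma dual_diagV (Q : 'M[F]_n) : Q \in unitmx ->
  dual_diag Q \in unitmx /\ invmx (dual_diag Q) = dual_diag (invmx Q).
Proof.
move=> uQ; have PP : dual_diag Q *m dual_diag (invmx Q) = 1%:M.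
  rewrite /dual_diag mulmx_block !(mulmx0, mul0mx, addr0, add0r) mulmxV //.
  by rewrite -trmx_mul invmxK mulmxV // trmx1 -scalar_mx_block.
have [uP _] := mulmx1_unit PP; split=> //.
by rewrite -[LHS]mulmx1 -PP mulKmx.
Qed.

(** The right factor is [dual_diag (invmx Q)] rather than an inverse, so the block formula and the
    compatibility with [Phi_star] hold for every [Q]. *)
Definition dual_conj (Q : 'M[F]_n) X := dual_diag Q *m X *m dual_diag (invmx Q).

Lemma dual_conjE (Q A B C D : 'M[F]_n) :
  dual_conj Q (block_mx A B C D) =
  block_mx (Q *m A *m invmx Q) (Q *m B *m Q^T)
    ((invmx Q)^T *m C *m invmx Q) ((invmx Q)^T *m D *m Q^T).
Proof.
rewrite /dual_conj /dual_diag invmxK !mulmx_block.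
by rewrite !(mulmx0, mul0mx, addr0, add0r).
Qed.

Lemma dual_conjK (Q : 'M[F]_n) : Q \in unitmx ->
  cancel (dual_conj Q) (dual_conj (invmx Q)).
Proof.
move=> uQ X; have [uP eP] := dual_diagV uQ.
by rewrite /dual_conj invmxK -eP !mulmxA mulVmx // mul1mx mulmxKV.
Qed.

Lemma dual_conjVK (Q : 'M[F]_n) : Q \in unitmx ->
  cancel (dual_conj (invmx Q)) (dual_conj Q).
Proof. by have := @dual_conjK (invmx Q); rewrite invmxK unitmx_inv. Qed.

Lemma dual_conj_superpart (Q : 'M[F]_n) b X :
  X \in superpart F n b -> dual_conj Q X \in superpart F n b.
Proof.
case: b; [case/superpart_odd|case/superpart_even] => A [B ->];
  by rewrite dual_conjE mem_superpart ?block_mxKul ?block_mxKdr ?block_mxKur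
     ?block_mxKdl !(mulmx0, mul0mx) eqxx.
Qed.

Lemma dual_conj_superautomorphism (Q : 'M[F]_n) : Q \in unitmx ->
  superautomorphism (dual_conj Q).
Proof.
move=> uQ; have K := dual_conjK uQ.
have K' := dual_conjVK uQ.
split.
- by move=> a X Y; rewrite /dual_conj mulmxDr -scalemxAr mulmxDl -scalemxAl.
- by exists (dual_conj (invmx Q)).
- move=> X Y; have [uP eP] := dual_diagV uQ.
  by rewrite /dual_conj -eP !mulmxA mulmxKV.
move=> b Y; split=> [hY|[X hX ->]]; last exact: dual_conj_superpart.
by exists (dual_conj (invmx Q) Y); rewrite ?K' //; exact: dual_conj_superpart.
Qed.

(** For invertible [Q], the block diagonal matrix P = [dual_diag Q] satisfies P Phi P^T = Phi: it is
    an isometry of the pairing between the two halves. *)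
Lemma dual_conj_Phi_star (Q : 'M[F]_n) X :
  dual_conj Q (Phi_star X) = Phi_star (dual_conj Q X).
Proof.
rewrite -(submxK X) Phi_star_block !dual_conjE Phi_star_block.
by rewrite !trmx_mul !trmxK !mulmxA mulmxN mulNmx.
Qed.

(** * Transport of gradings, and homogeneous components in coordinates *)

Variable gT : finGroupType.
Implicit Type Rg : gT -> {vspace 'M[F]_(n + n)}.

(** The new grading is the image of the old one. This serves first for the automorphism that brings
    [star] to the form [Phi_star], then for the final isomorphism. *)
Lemma transport_graded_superinvolution Rg star star' phi :
  superautomorphism phi -> graded_superinvolution Rg star ->
  (forall X, phi (star X) = star' (phi X)) ->
  exists Rg' : gT -> {vspace 'M[F]_(n + n)},
    graded_superinvolution Rg' star' /\ forall g, maps_onto phi (Rg g) (Rg' g).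
Proof.
case=> lin_phi bij_phi phiM phi_part; case=> -[dR sR RM R01].
case=> lin_star invol star_part starM starR phi_star.
have [f fE] := linear_lfun lin_phi; have [psi phiK psiK] := bij_phi.
pose Rg' g := (f @: Rg g)%VS.
have img g : maps_onto phi (Rg g) (Rg' g).
  move=> Y; split=> [/memv_imgP[X hX ->]|[X hX ->]].
    by exists X; rewrite ?fE.
  by rewrite -fE; exact: memv_img.
have phi_in g X : X \in Rg g -> phi X \in Rg' g by move=> hX; apply/img; exists X.
have phi_sp b X : X \in superpart F n b -> phi X \in superpart F n b.
  by move=> hX; apply/phi_part; exists X.
have f0 X : f X = 0 -> X = 0.
  by move=> fX0; apply: (can_inj phiK); rewrite -!fE fX0 linear0.
have phiD X Y : phi (X + Y) = phi X + phi Y by rewrite -!fE linearD.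
exists Rg'; split=> //; split; [split| split|].
- apply/directv_sum_independent=> us hus us0 g _.
  have psi_us h : psi (us h) \in Rg h.
    by have /img[X hX ->] := hus h isT; rewrite phiK.
  have : \sum_h psi (us h) = 0.
    apply: f0; rewrite linear_sum -[RHS]us0; apply: eq_bigr => h _.
    exact: etrans (fE _) (psiK _).
  move/directv_sum_independent: dR => /(_ (fun h => psi (us h))) dR s0.
  by rewrite -[us g]psiK (dR (fun h _ => psi_us h) s0 g) // -fE linear0.
- rewrite -limg_sum sR; apply/eqP; rewrite eqEsubv subvf /=; apply/subvP=> Y _.
  by rewrite -[Y]psiK -fE memv_img // memvf.
- move=> g h _ _ /img[X hX ->] /img[Y hY ->]; rewrite -phiM.
  exact/phi_in/RM.
- move=> g; split; last first.
    apply/directv_addP/eqP; rewrite -subv0 -even_odd_direct.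
    by apply: capvS; exact: capvSr.
  apply/eqP; rewrite eqEsubv subv_add !capvSl !andbT.
  apply/subvP=> _ /img[X + ->].
  rewrite (R01 g).1 => /memv_addP[X0 + [X1 + ->]]; rewrite phiD.
  rewrite memv_cap => /andP[r0 s0]; rewrite memv_cap => /andP[r1 s1].
  by apply: memv_add; rewrite memv_cap; rewrite phi_in ?phi_sp.
- move=> a X Y; rewrite -[X]psiK -[Y]psiK.
  by rewrite -lin_phi -!phi_star lin_star lin_phi.
- by move=> X; rewrite -[X]psiK -!phi_star invol.
- by move=> b _ /phi_part[X hX ->]; rewrite -phi_star phi_sp // star_part.
- move=> a b _ _ /phi_part[X hX ->] /phi_part[Y hY ->].
  by rewrite -!phi_star -!phiM -phi_star (starM a b) // -!fE linearZ.
move=> g Y; split=> [/img[X /starR[Z hZ ->] ->]|[_ /img[X hX ->] ->]].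
  by exists (phi Z); rewrite -?phi_star ?phi_in.
by rewrite -phi_star phi_in //; apply/starR; exists X.
Qed.

Lemma superautomorphism_matrix_units phi E :
  superautomorphism phi -> matrix_units E ->
  matrix_units (fun i j => phi (E i j)).
Proof.
case=> /linear_lfun[f fE] [psi phiK psiK] phiM _ [EM E1]; split=> [i j k l|].
  by rewrite -phiM EM; case: ifP; rewrite // -fE linear0.
(* The image of 1 is a unit element for the image of [phi], which is everything. *)
have phi1 : phi 1%:M = 1%:M.
  by rewrite -[LHS]mulmx1 -{2}(psiK 1%:M) -phiM mul1mx psiK.
rewrite -phi1 -E1 -[RHS]fE linear_sum.
by apply: eq_bigr => i _; exact/esym/fE.
Qed.

Lemma superautomorphism_elementary_wrt Rg Rg' phi E (t : (n + n).-tuple gT) :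
  superautomorphism phi -> (forall g, maps_onto phi (Rg g) (Rg' g)) ->
  elementary_wrt E t Rg -> elementary_wrt (fun i j => phi (E i j)) t Rg'.
Proof.
case=> _ /bij_inj inj_phi _ _ img elE i j g.
split=> [/img[X hX /inj_phi eX]|/elE hE]; first by apply/elE; rewrite eX.
by apply/img; exists (E i j).
Qed.

Lemma directv_component_eq Rg g h (X : 'M[F]_(n + n)) :
  X != 0 -> directv (\sum_g Rg g)%VS -> X \in Rg g -> X \in Rg h -> g = h.
Proof.
move=> nzX /directv_sumP dR Xg Xh; apply: contraNeq nzX => ngh.
rewrite -memv0 -(dR g isT) memv_cap Xg (subvP (sumv_sup h _ (subvv _))) //.
by rewrite eq_sym.
Qed.

(** The matrix units conjugated by [S] are homogeneous and span, so a matrix is the sum of its parts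
    supported on the entries of each degree. Directness of the grading identifies these parts with
    the homogeneous components. *)
Lemma elementary_deg_preserving Rg (t : 'I_(n + n) -> gT) (S : 'M[F]_(n + n)) :
  S \in unitmx -> directv (\sum_g Rg g)%VS ->
  (forall i j, invmx S *m delta_mx i j *m S \in Rg ((t i)^-1 * t j)%g) ->
  forall g X, X \in Rg g <->
    deg_preserving (fun i => t i * g)%g t (S *m X *m invmx S).
Proof.
move=> uS dR hE.
have sub g Y : deg_preserving (fun i => t i * g)%g t Y ->
    invmx S *m Y *m S \in Rg g.
  move=> hY; rewrite (matrix_sum_delta Y) mulmx_sumr mulmx_suml.
  apply: memv_suml => i _; rewrite mulmx_sumr mulmx_suml.
  apply: memv_suml => j _; rewrite -scalemxAr -scalemxAl.
  have [->|/hY e] := eqVneq (Y i j) 0; first by rewrite scale0r mem0v.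
  by apply: memvZ; have := hE i j; rewrite -e mulKg.
move=> g X; split=> [hX|/sub]; last first.
  by rewrite !mulmxA mulVmx // mul1mx mulmxKV.
set Y := S *m X *m invmx S.
(* The part of [Y] supported on the entries (i, j) of degree [h]. *)
pose Yp h := \matrix_(i, j) (if (t i * h)%g == t j then Y i j else 0).
have hYp h : invmx S *m Yp h *m S \in Rg h.
  by apply: sub => i j; rewrite mxE; case: (eqVneq (t i * h)%g (t j)); rewrite ?eqxx.
have sumYp : \sum_h Yp h = Y.
  apply/matrixP=> i j; rewrite summxE (bigD1 ((t i)^-1 * t j)%g) //= mxE.
  rewrite mulKVg eqxx.
  rewrite big1 ?addr0 // => h nh; rewrite mxE; case: eqP => // e.
  by rewrite -e mulKg eqxx in nh.
have XE : \sum_h invmx S *m Yp h *m S = \sum_h (if h == g then X else 0).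
  rewrite -mulmx_suml -mulmx_sumr sumYp /Y -big_mkcond big_pred1_eq.
  by rewrite !mulmxA mulVmx // mul1mx mulmxKV.
move/eqP: XE; rewrite (directv_sum_unique dR) //; last first.
  by move=> h _; case: eqP => [->|_]; rewrite ?mem0v.
move/forall_inP=> /(_ g isT); rewrite eqxx => /eqP XE i j.
rewrite /Y -XE !mulmxA mulmxV // mul1mx mulmxK // mxE.
by case: (eqVneq (t i * g)%g (t j)); rewrite ?eqxx.
Qed.

End Superalgebra.

(** * The graded bilinear form and its homogeneous dual bases *)

Section Core.

Variables (F : fieldType) (n : nat) (gT : finGroupType).
Hypothesis abG : abelian [set: gT].
Implicit Type Rg : gT -> {vspace 'M[F]_(n + n)}.

Let mulgC (x y : gT) : (x * y = y * x)%g.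
Proof. by apply: (centsP abG); rewrite inE. Qed.

Variable im : F.
Hypothesis im2 : im * im = -1.

(* Twisting the superinvolution by a square root of -1 on the odd part turns it
   into the ordinary anti-automorphism X |-> twist *m X^T *m untwist, whose
   square is the conjugation by diag(1, -1). *)
Definition twist : 'M[F]_(n + n) := block_mx 0 1%:M im%:M 0.
Definition untwist : 'M[F]_(n + n) := block_mx 0 (- im)%:M 1%:M 0.

Lemma twistK : twist *m untwist = 1%:M.
Proof.
rewrite mulmx_block !(mulmx0, mul0mx, mulmx1, addr0, add0r) -scalar_mxM.
by rewrite mulrN im2 opprK -scalar_mx_block.
Qed.

Lemma twist_unit : twist \in unitmx.
Proof. by have [] := mulmx1_unit twistK. Qed.

Lemma untwist_unit : untwist \in unitmx.
Proof. by have [] := mulmx1_unit twistK. Qed.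

(** On X0 + X1, even plus odd, the twisted transpose is X0^* + [im] X1^*, and both parts of a
    homogeneous element are homogeneous of the same degree. *)
Lemma twisted_trmx_graded Rg :
  graded_superinvolution Rg (@Phi_star F n) ->
  forall g X, X \in Rg g -> twist *m X^T *m untwist \in Rg g.
Proof.
case=> -[_ _ _ R01] _ starR g X; rewrite (R01 g).1.
case/memv_addP=> X0 + [X1 + ->]; rewrite memv_cap => /andP[r0 s0].
rewrite memv_cap => /andP[r1 s1].
have st Y : Y \in Rg g -> Phi_star Y \in Rg g.
  by move=> hY; apply/starR; exists Y.
have -> : twist *m (X0 + X1)^T *m untwist = Phi_star X0 + im *: Phi_star X1.
  have [A [D ->]] := superpart_even s0; have [B [C ->]] := superpart_odd s1.
  rewrite add_block_mx !addr0 !add0r tr_block_mx !Phi_star_block !mulmx_block.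
  rewrite !(mulmx0, mul0mx, mulmx1, mul1mx, addr0, add0r, trmx0, oppr0).
  rewrite scale_block_mx !scaler0 add_block_mx !(addr0, add0r).
  rewrite !mul_scalar_mx !mul_mx_scalar scalerA mulNr im2 opprK scale1r.
  by rewrite scaleNr scalerN.
by rewrite -(R01 g).1; apply: memvD; [|apply: memvZ]; apply: st.
Qed.

Lemma homogeneous_symplectic_units Rg :
  (0 < n)%N -> 2%:R != 0 :> F ->
  graded_superinvolution Rg (@Phi_star F n) -> elementary_grading Rg ->
  exists (g0 : gT) (u : 'I_n -> gT) (Q : 'M[F]_n),
    [/\ Q \in unitmx,
        codom u = flatten
          [seq nseq (count_mem (enum_val i) (codom u)) (enum_val i)
          | i <- enum 'I_#|gT|]
      & let tau k := match split k with
                     | inl i => u i | inr j => (g0 * (u j)^-1)%g end in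
        forall i j, dual_conj (invmx Q) (delta_mx i j) \in
                      Rg ((tau i)^-1 * tau j)%g].
Proof.
move=> n_gt0 nz2 gsR [t0 [E [muE elE]]].
have [S uS ES] := matrix_units_conj muE; pose t := tnth t0.
have [[dR _ _ _] _ _] := gsR.
have memR g X : X \in Rg g <->
    deg_preserving (fun i => t i * g)%g t (S *m X *m invmx S).
  by apply: elementary_deg_preserving => // i j; rewrite -ES; apply/elE.
have uST : S^T \in unitmx by rewrite unitmx_tr.
(* In the coordinates Y = S X S^-1, the anti-automorphism reads Y |-> Mi Y^T M; thus [M] is the Gram
   matrix of the form and [Mi] its inverse. *)
pose Mi := S *m twist *m S^T; pose M := invmx S^T *m untwist *m invmx S.
have uM : M \in unitmx by rewrite !unitmx_mul !unitmx_inv uST untwist_unit.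
have MiM : Mi *m M = 1%:M.
  rewrite /Mi /M !mulmxA mulmxK // -(mulmxA S) twistK mulmx1.
  by rewrite mulmxV.
have [uMi _] := mulmx1_unit MiM.
have MiE : invmx M = Mi by rewrite -[RHS]mulmx1 -(mulmxV uM) mulmxA MiM mul1mx.
pose i0 := lshift n (Ordinal n_gt0).
have [a [b nzMi]] : exists a b, Mi a b != 0.
  apply/matrix0Pn/eqP => Mi0; move: MiM; rewrite Mi0 mul0mx.
  by move/matrixP/(_ i0 i0)/eqP; rewrite !mxE eqxx eq_sym oner_eq0.
(* The degree of the form, read off a nonzero entry of [Mi]. *)
pose g0 := (t a * t b)%g.
have hM : deg_preserving t (fun j => g0 * (t j)^-1)%g M.
  move=> k j nzM.
  (* The unit [E k b] is sent to column b of [Mi] times row k of [M]. Its entry (a, j) is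
     [Mi a b * M k j], nonzero, so comparing degrees gives t_k t_j = g0. *)
  have : invmx S *m delta_mx k b *m S \in Rg ((t k)^-1 * t b)%g.
    by rewrite -ES; apply/elE.
  move/(twisted_trmx_graded gsR)/memR.
  have -> : S *m (twist *m (invmx S *m delta_mx k b *m S)^T *m untwist)
              *m invmx S = Mi *m delta_mx b k *m M.
    by rewrite !trmx_mul trmx_delta trmx_inv /Mi /M !mulmxA.
  have -> : Mi *m delta_mx b k *m M = col b Mi *m row k M.
    by rewrite colE rowE -(mul_delta_mx (0 : 'I_1)) !mulmxA.
  move/(_ a j); rewrite mxE big_ord1 [col _ _ _ _]mxE [row _ _ _ _]mxE.
  rewrite mulf_neq0 // => /(_ isT) e.
  by apply: (mulIg (t j)); rewrite mulgKV -e mulgA (mulgC (t k)) -mulgA mulKVg.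
have hMi : deg_preserving (fun j => g0 * (t j)^-1)%g t Mi.
  by rewrite -MiE; apply: deg_preserving_inv.
have swap x y : (x = g0 * y^-1 -> y = g0 * x^-1)%g.
  by move=> ->; rewrite invMg invgK mulgC -mulgA mulVg mulg1.
(* [K *m L] and [K' *m L'] are S diag(1, 0) S^-1 and S diag(0, 1) S^-1, the projectors onto the two
   halves in the homogeneous coordinates. *)
pose K := lsubmx S; pose L := usubmx (invmx S).
pose K' := rsubmx S; pose L' := dsubmx (invmx S).
have SE : S = row_mx K K' by rewrite hsubmxK.
have VE : invmx S = col_mx L L' by rewrite vsubmxK.
have KL1 : K *m L + K' *m L' = 1%:M by rewrite -mul_row_col -SE -VE mulmxV.
have LK : L *m K = 1%:M.
  have := mulVmx uS; rewrite {1}VE {1}SE mul_col_row scalar_mx_block.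
  by case/eq_block_mx.
(* The asymmetry of the form acts as -[im] on one half and [im] on the other. It preserves degrees,
   since [M] and [Mi] each exchange x and g0 x^-1; hence so does the projector K L = (1 + im Mi M^T)
   / 2. *)
have W : Mi *m M^T = - im *: (K *m L) + im *: (K' *m L').
  rewrite /Mi /M !trmx_mul !trmx_inv trmxK -!mulmxA mulKVmx //.
  rewrite VE SE tr_block_mx !trmx0 !tr_scalar_mx !mulmxA.
  rewrite !mul_row_block !mulmx0 !addr0 !add0r mul_row_col.
  by rewrite mulmx1 mulmx1 !mul_mx_scalar -!scalemxAl addrC.
have hKL : deg_preserving t t (K *m L).
  have hW : deg_preserving t t (1%:M + im *: (Mi *m M^T)).
    apply: deg_preservingD; first exact: deg_preserving1.
    apply: deg_preservingZ.
    apply: (@deg_preserving_mul _ _ _ _ _ _ (fun j => g0 * (t j)^-1)%g).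
      by move=> i j /hMi e; apply: swap; rewrite -e.
    by move=> i j; rewrite mxE => /hM e; rewrite -e.
  have -> : K *m L = 2%:R^-1 *: (1%:M + im *: (Mi *m M^T)).
    rewrite W -KL1 [im *: _]scalerDr !scalerA mulrN im2 opprK scale1r scaleN1r.
    by rewrite addrACA subrr addr0 -mulr2n -scaler_nat scalerA mulVf // scale1r.
  exact: deg_preservingZ.
move/deg_proj_comm: hKL => hKL.
(* The degree projectors restricted to the first half; they remain orthogonal idempotents because K
   L commutes with [deg_proj t g] and L K = 1. *)
pose Pi g := L *m deg_proj t g *m K.
have PiM g h : Pi g *m Pi h = (g == h)%:R *: Pi h.
  rewrite /Pi -!mulmxA (mulmxA K) (mulmxA (K *m L)) -hKL -!mulmxA LK mulmx1.
  by rewrite (mulmxA (deg_proj t g)) deg_projM -scalemxAl -scalemxAr.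
have Pi1 : \sum_g Pi g = 1%:M.
  by rewrite -mulmx_suml -mulmx_sumr deg_proj_sum mulmx1.
have [u0 [Q0 [uQ0 hQ0]]] := homogeneous_basis PiM Pi1.
have [s su] := codom_perm_flatten u0.
pose u := u0 \o s; pose Q := row_perm s Q0.
have uQ : Q \in unitmx by rewrite /Q row_permE unitmx_mul unitmx_perm.
have hQ g : deg_proj u g *m Q = Q *m Pi g.
  rewrite /Q [in RHS]row_permE -mulmxA -hQ0 -row_permE.
  by apply/matrixP=> i j; rewrite mul_diag_mx [in RHS]mxE mul_diag_mx !mxE.
exists g0, u, Q; split=> //.
have hQL : deg_preserving u t (Q *m L).
  apply/deg_proj_comm => g; rewrite mulmxA hQ /Pi.
  by rewrite -!mulmxA hKL -mulmxA (mulmxA L K) LK mul1mx.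
have hKQ : deg_preserving t u (K *m invmx Q).
  apply/deg_proj_comm => g.
  have -> : K *m invmx Q *m deg_proj u g = K *m Pi g *m invmx Q.
    by rewrite -[RHS]mulmxA -[Pi g *m _](mulKmx uQ) (mulmxA Q) -hQ mulmxK // mulmxA.
  by rewrite /Pi !mulmxA -hKL mulmxA -(mulmxA _ L) LK mulmx1 -mulmxA.
(* The form determines the second half from the first: L' = im K^T M. A dual basis vector therefore
   has degree g0 times the inverse of the original one. *)
have hL' : deg_preserving (fun j => g0 * (u j)^-1)%g t ((invmx Q)^T *m L').
  have -> : (invmx Q)^T *m L' = im *: ((K *m invmx Q)^T *m M).
    have -> : L' = im *: (K^T *m M).
      have -> : L' = dsubmx (twist *m S^T *m M).
        by congr dsubmx; rewrite -[LHS]mulmx1 -MiM /Mi -!mulmxA mulKmx.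
      rewrite SE tr_row_mx mul_block_col mul_col_mx col_mxKd mul0mx addr0.
      by rewrite mul_scalar_mx -scalemxAl.
    by rewrite -scalemxAr trmx_mul mulmxA.
  apply: deg_preservingZ.
  apply: (@deg_preserving_mul _ _ _ _ _ _ (fun k => g0 * (t k)^-1)%g).
    by move=> i k; rewrite mxE => /hKQ ->.
  by move=> k j /hM /swap ->.
move=> tau; pose Z := col_mx (Q *m L) ((invmx Q)^T *m L').
have hZ : deg_preserving tau t Z.
  move=> k j; rewrite /tau mxE.
  by case: (split k) => i; [exact: hQL|exact: hL'].
have [uP PV] := dual_diagV uQ.
have ZE : Z = dual_diag Q *m invmx S.
  by rewrite VE /dual_diag mul_block_col !mul0mx addr0 add0r.
have uZ : Z \in unitmx by rewrite ZE unitmx_mul unitmx_inv uS uP.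
have ZV : S *m dual_diag (invmx Q) = invmx Z.
  by rewrite -[LHS](mulmxK uZ) ZE -PV !mulmxA mulmxKV // mulmxV // mul1mx.
(* The rows of [Z] form the homogeneous basis with degrees [tau]. In the original homogeneous
   coordinates the matrix unit is column i of Z^-1 times row j of Z. *)
move=> i j; apply/memR => k l.
have -> : S *m dual_conj (invmx Q) (delta_mx i j) *m invmx S =
    col i (invmx Z) *m row j Z.
  rewrite /dual_conj invmxK !mulmxA ZV -mulmxA -ZE colE rowE.
  by rewrite -(mul_delta_mx (0 : 'I_1)) !mulmxA.
rewrite mxE big_ord1 [col _ _ _ _]mxE [row _ _ _ _]mxE mulf_eq0.
case/norP=> /(deg_preserving_inv uZ hZ) -> /hZ <-.
by rewrite mulKVg.
Qed.

End Core.

(** * Assembly of the graded isomorphism and of the defining tuple *)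

Theorem theorem5p3 (F : closedFieldType) (charF0 : [pchar F] =i pred0)
  (gT : finGroupType) (abG : abelian [set: gT])
  (n : nat) (ntR : nontrivial_superalgebra F n)
  (Rg : gT -> {vspace 'M[F]_(n + n)})
  (star : 'M[F]_(n + n) -> 'M[F]_(n + n))
  (Rgstar : graded_superinvolution Rg star)
  (elemRg : elementary_grading Rg)
  (trstar : is_transpose star) :
  (exists (r : nat) (g : 'I_r -> gT) (p q : 'I_r -> nat) (s : {perm 'I_r})
     (t : (n + n).-tuple gT) (Rg' : gT -> {vspace 'M[F]_(n + n)})
     (phi : 'M[F]_(n + n) -> 'M[F]_(n + n)),
     [/\ injective g,
         (\sum_i p i)%N = n,
         (\sum_i q i)%N = n
       & forall i j, (g i * g (s i))%g = (g j * g (s j))%g] /\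
     [/\ tval t = paired_seq g p q s,
         graded_superinvolution Rg' (@Phi_star F n),
         elementary_wrt (fun i j => delta_mx i j) t Rg'
       & graded_star_isomorphism Rg star Rg' (@Phi_star F n) phi]) /\
  (forall X : 'M[F]_(n + n),
     skew_elt (@Phi_star F n) X <->
     exists A B C : 'M[F]_n,
       [/\ B^T = B, C^T = - C & X = block_mx A B C (- A^T)]) /\
  (forall X : 'M[F]_(n + n),
     symmetric_elt (@Phi_star F n) X <->
     exists A B C : 'M[F]_n,
       [/\ B^T = - B, C^T = C & X = block_mx A B C A^T]).
Proof.
split; last by split; [exact: skew_Phi_star | exact: symmetric_Phi_star].
have n_gt0 : (0 < n)%N.
  move: ntR; clear; case: n => // ntR0; case: ntR0; apply/eqP; rewrite -subv0.
  by apply/subvP=> X _; rewrite (flatmx0 X) mem0v.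
have nz2 : 2%:R != 0 :> F.
  by apply/negP=> z; have := charF0 2; rewrite !inE z.
have [im im2] : exists im : F, im * im = -1.
  have [im] := @solve_monicpoly F 2 (fun i => - (i == 0)%:R) isT.
  rewrite big_ord_recl big_ord1 /= mulr0n oppr0 mul0r addr0 mulr1 => e.
  by exists im; rewrite -expr2 e.
have [theta aut_theta theta_star] := trstar.
have theta_star' X : theta (star X) = Phi_star (theta X).
  by rewrite Phi_starE theta_star.
have [R1 [gsR1 img1]] :=
  transport_graded_superinvolution aut_theta Rgstar theta_star'.
have elemR1 : elementary_grading R1.
  by have [t [E [muE elE]]] := elemRg; exists t, (fun i j => theta (E i j));
     split; [exact: superautomorphism_matrix_units
            | exact: superautomorphism_elementary_wrt elE].
have [g0 [u [Q [uQ u_flat]]]] :=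
  homogeneous_symplectic_units abG im2 n_gt0 nz2 gsR1 elemR1.
set tau := fun _ => _; move=> /= hQ.
pose phi := dual_conj Q \o theta.
have aut_phi : superautomorphism phi.
  exact: superautomorphism_comp (dual_conj_superautomorphism uQ) aut_theta.
have phi_star X : phi (star X) = Phi_star (phi X).
  by rewrite /phi /= theta_star' dual_conj_Phi_star.
have [R2 [gsR2 img2]] :=
  transport_graded_superinvolution aut_phi Rgstar phi_star.
pose g (i : 'I_#|gT|) := enum_val i.
pose p (i : 'I_#|gT|) := count_mem (g i) (codom u).
have sf_inj : injective (fun i => enum_rank (g0 * (g i)^-1)%g).
  by move=> i j /enum_rank_inj/mulgI/invg_inj/enum_val_inj.
pose s := perm sf_inj.
have gs i : g (s i) = (g0 * (g i)^-1)%g by rewrite permE /g enum_rankK.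
have sum_p : (\sum_i p i)%N = n.
  transitivity (size (codom u)); last by rewrite size_codom card_ord.
  rewrite u_flat size_flatten /shape -map_comp sumnE big_map big_enum /=.
  by apply: eq_bigr => i _; rewrite size_nseq.
have mulgC (x y : gT) : (x * y = y * x)%g by apply: (centsP abG); rewrite inE.
(* The dual of the block of [g i] has degree [g (s i)] and the same length [p i], whence q (s i) = p
   i. *)
exists #|gT|, g, p, (fun j => p (s^-1 j)%g), s.
exists [tuple of [tuple u i | i < n] ++ [tuple (g0 * (u i)^-1)%g | i < n]].
exists R2, phi.
split; split=> //.
- exact: enum_val_inj.
- rewrite (reindex_inj (@perm_inj _ s)) -[RHS]sum_p.
  by apply: eq_bigr => i _; rewrite permK.
- by move=> i j; rewrite !gs ![(g _ * _)%g]mulgC !mulgKV.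
- rewrite /paired_seq; congr (_ ++ _); first exact: u_flat.
  transitivity (map (fun x => g0 * x^-1)%g (codom u)).
    by rewrite codomE -map_comp.
  rewrite {1}u_flat map_flatten -map_comp; congr flatten.
  by apply: eq_map => i; rewrite /= map_nseq permK -gs.
have lab k : tnth [tuple of [tuple u i | i < n] ++
    [tuple (g0 * (u i)^-1)%g | i < n]] k = tau k.
  rewrite /tau; case: (splitP k) => i e.
    have -> : k = lshift n i by apply: val_inj.
    by rewrite tnth_lshift tnth_mktuple.
  have -> : k = rshift n i by apply: val_inj.
  by rewrite tnth_rshift tnth_mktuple.
have deltaR i j : delta_mx i j \in R2 ((tau i)^-1 * tau j)%g.
  have /img1[X hX eX] := hQ i j.
  by apply/img2; exists X; rewrite // /phi /= -eX dual_conjVK.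
move=> i j h; rewrite !lab; split=> [hd|-> //].
(* Conversely, a nonzero matrix unit lies in only one component of a direct sum. *)
have [[dR _ _ _] _ _] := gsR2.
apply: directv_component_eq dR hd (deltaR i j).
apply/eqP => /matrixP/(_ i j)/eqP.
by rewrite !mxE !eqxx oner_eq0.
Qed.
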